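(* For every $k\ge1$, the map $\varphi_k:\mathcal{R}[k]\to\mathcal{R}[k+1]$ given by $\varphi_k(Q^I)=Q^IQ^0$ is an $\mathcal{A}^{op}$-coalgebra map (a coalgebra map commuting with the action of the opposite of the Steenrod algebra). Moreover: (i) if $I\notin 2\mathbb{N}^k$ and $I$ is admissible, then $\varphi_k(Q^I)=0$; (ii) if $I=\sum_{i=0}^{k-1}2a_iI_{k,i}$ (with natural numbers $a_i\geq 0$), then $\varphi_k(Q^I)=Q^J$, where $J=\sum_{i=0}^{k-1}a_iI_{k+1,i+1}$.
   Context: All vector spaces are over $\mathbb{F}_2$; binomial coefficients are taken mod 2; $\mathbb{N}$ includes $0$. $\mathcal{F}_0$ is the free graded associative unital algebra on $\{Q^i\mid i\ge0\}$, $|Q^i|=i$, with coproduct the algebra map determined by $\psi(Q^i)=\sum_{t=0}^iQ^{i-t}\otimes Q^t$. For $I=(i_k,\dots,i_1)\in\mathbb{N}^k$ put $Q^I=Q^{i_k}\cdots Q^{i_1}$, length $l(I)=k$, excess $e(I)=i_k-\sum_{t=1}^{k-1}i_t$; sums of sequences of the same length are termwise. $\mathcal{U}$ is the quotient of $\mathcal{F}_0$ by the two-sided ideal generated by monomials of negative excess. The Dyer-Lashof algebra $\mathcal{R}$ is the quotient Hopf algebra of $\mathcal{U}$ by the ideal generated by the Adem relations $Q^rQ^s-\sum_{t>0}\binom{t-s-1}{2t-r}Q^{r+s-t}Q^t$ for $r>2s$. $I=(i_k,\dots,i_1)$ is admissible (for $\mathcal{R}$) if $i_{t+1}\le2i_t$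 for $1\le t<k$. $\mathcal{R}[k]$ is the subcoalgebra of $\mathcal{R}$ spanned by monomials of length $k$; a basis consists of the $Q^I$ with $I$ admissible of length $k$ and $e(I)\ge0$. The sequences $I_{k,t}$ ($0\le t\le k-1$) of length $k$ are $I_{k,t}=(2^{k-1}-2^{t-1},\dots,2^{k-t}-1,\,2^{k-t-1},\dots,2,1)$, i.e. the first $t$ entries are $2^{k-j}-2^{t-j}$ for $j=1,\dots,t$ and the remaining $k-t$ entries are $2^{k-t-1},2^{k-t-2},\dots,1$; its degree is $2^k-2^t$. In particular $I_{k,0}=(2^{k-1},\dots,2,1)$. The action of the opposite of the mod 2 Steenrod algebra $\mathcal{A}$ on $\mathcal{F}_0$, which passes to $\mathcal{U}$ and $\mathcal{R}$ and preserves each $\mathcal{R}[k]$, is given by operations $Sq^a$ (also written $Sq^a_*$) lowering degree by $a$: $Sq^aQ^b=\binom{b-a}{a}Q^{b-a}$ for $b\ge0$; $Sq^a(Q^0r)=Q^0Sq^a(r)$; $Sq^a(Q^br)=\sum_t\binom{b-a}{a-2t}Q^{b-a+t}Sq^t(r)$ for $b>0$; with $Q^j=0$ for $j<0$. *)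

(* Defs.v *)
From HB Require Import structures.
From mathcomp Require Import all_boot all_order all_algebra.
From mathcomp Require Import finmap.
From mathcomp.multinomials Require Import monalg.
From mathcomp.classical Require Import boolp.

Set Implicit Arguments.
Unset Strict Implicit.
Unset Printing Implicit Defensive.

Import GRing.Theory Num.Theory.
Local Open Scope ring_scope.
Local Open Scope quotient_scope.

Notation F2 := 'F_2.

Lemma scaleF2 (V : lmodType F2) (c : F2) (v : V) : c *: v = v *+ c.
Proof. by rewrite -{1}[c]natr_Zp scaler_nat. Qed.

Section Span.
Variables (V : lmodType F2) (S : V -> Prop).

Definition span : {pred V} := fun v =>
  `[< exists s : seq (F2 * V),
        (forall p, p \in s -> S p.2) /\ v = \sum_(p <- s) p.1 *: p.2 >].

Lemma span_closed : submod_closed span.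
Proof.
split=> [|c u v]; first by apply/asboolP; exists [::]; rewrite big_nil.
move=> /asboolP[su [hu ->]] /asboolP[sv [hv ->]]; apply/asboolP.
exists ([seq (c * p.1, p.2) | p <- su] ++ sv); split.
  by move=> p; rewrite mem_cat => /orP[/mapP[q /hu Sq ->]|/hv].
rewrite big_cat big_map scaler_sumr; congr (_ + _).
by apply: eq_bigr => p _; rewrite scalerA.
Qed.

HB.instance Definition _ := GRing.isSubmodClosed.Build F2 V span span_closed.

Lemma mem_span v : S v -> v \in span.
Proof.
move=> Sv; apply/asboolP; exists [:: (1, v)]; rewrite big_seq1 scale1r.
by split=> // p; rewrite inE => /eqP->.
Qed.

Lemma span_ind (W : lmodType F2) (f : {linear V -> W}) (P : submodClosed W) :
  (forall v, S v -> f v \in P) -> forall v, v \in span -> f v \in P.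
Proof.
move=> h v /asboolP[s [hs ->]]; rewrite linear_sum big_seq.
by apply: rpred_sum => p /hs Sp; rewrite linearZ rpredZ // h.
Qed.

Definition subsp : Type := {v : V | v \in span}.
HB.instance Definition _ := SubChoice.on subsp.
HB.instance Definition _ := [SubChoice_isSubLmodule of subsp by <:].

Definition insp (v : V) (h : v \in span) : subsp := exist _ v h.

Definition inclsp : {linear subsp -> V} := \val.

Definition quotsp : Type := {ideal_quot span}.
HB.instance Definition _ := GRing.Zmodule.on quotsp.

Definition projsp_fun (v : V) : quotsp := \pi_({ideal_quot span}) v.

Lemma projsp_eq u v : u - v \in span -> projsp_fun u = projsp_fun v.
Proof. by rewrite Quotient.idealrBE => /eqP. Qed.

Lemma repr_projsp v : repr (projsp_fun v) - v \in span.
Proof. by rewrite Quotient.idealrBE reprK. Qed.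

Lemma projsp_fun_repr (x : quotsp) : projsp_fun (repr x) = x.
Proof. exact: reprK. Qed.

Fact projsp_zmod : zmod_morphism projsp_fun.
Proof. exact: (raddfB (\pi_({ideal_quot span}))). Qed.
HB.instance Definition _ :=
  GRing.isZmodMorphism.Build V quotsp projsp_fun projsp_zmod.

Definition scaleq (c : F2) (x : quotsp) : quotsp := projsp_fun (c *: repr x).

Lemma scaleqE c x : scaleq c x = x *+ c.
Proof. by rewrite /scaleq scaleF2 raddfMn /= projsp_fun_repr. Qed.

Fact scaleqA a b x : scaleq a (scaleq b x) = scaleq (a * b) x.
Proof.
by rewrite [scaleq b x]/scaleq scaleqE -raddfMn -scaleF2 scalerA.
Qed.
Fact scale1q : left_id 1 scaleq.
Proof. by move=> x; rewrite scaleqE. Qed.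
Fact scaleqDr : right_distributive scaleq +%R.
Proof. by move=> c x y; rewrite !scaleqE mulrnDl. Qed.
Fact scaleqDl x : {morph scaleq^~ x : a b / a + b}.
Proof. by move=> a b; rewrite /scaleq scalerDl raddfD. Qed.
HB.instance Definition _ := GRing.Zmodule_isLmodule.Build F2 quotsp
  scaleqA scale1q scaleqDr scaleqDl.

Fact projsp_scalable : scalable projsp_fun.
Proof. by move=> c v; rewrite [RHS]scaleqE scaleF2 raddfMn. Qed.
HB.instance Definition _ :=
  GRing.isScalable.Build F2 V quotsp *:%R projsp_fun projsp_scalable.

Definition projsp : {linear V -> quotsp} := projsp_fun.

Section Lift.
Variables (W : lmodType F2) (f : {linear V -> W}).
Hypothesis fS : forall v, S v -> f v = 0.

Lemma span_ker v : v \in span -> f v = 0.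
Proof.
move=> /asboolP[s [hs ->]]; rewrite linear_sum big1_seq // => p /hs Sp.
by rewrite linearZ /= fS ?scaler0.
Qed.

Definition liftsp_fun & (forall v, S v -> f v = 0) :=
  fun x : quotsp => f (repr x).
Let g := liftsp_fun fS.

Lemma liftsp_fun_proj v : g (projsp v) = f v.
Proof. by apply/eqP; rewrite -subr_eq0 -linearB span_ker ?repr_projsp. Qed.

Fact liftsp_linear : linear g.
Proof.
move=> c x y; rewrite -[x]projsp_fun_repr -[y]projsp_fun_repr.
by rewrite -[projsp_fun]/(projsp : V -> _) -linearP !liftsp_fun_proj linearP.
Qed.
HB.instance Definition _ := GRing.isLinear.Build F2 quotsp W *:%R g
  liftsp_linear.
Definition liftsp : {linear quotsp -> W} := g.

Lemma liftspE v : liftsp (projsp v) = f v.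
Proof. exact: liftsp_fun_proj. Qed.

End Lift.
End Span.

Section FreeModule.
Variables (T : choiceType) (V : lmodType F2) (h : T -> V).

Definition linext_fun (x : {malg F2[T]}) : V := \sum_(t <- msupp x) x@_t *: h t.

Fact linext_linear : linear linext_fun.
Proof.
have E (d : {fset T}) x : (msupp x `<=` d)%fset ->
    linext_fun x = \sum_(t <- d) x@_t *: h t.
  move=> sd; rewrite /linext_fun (big_fset_incl _ sd) // => t _ tx.
  by rewrite mcoeff_outdom ?scale0r.
move=> c x y; pose d := (msupp (c *: x + y) `|` msupp x `|` msupp y)%fset.
rewrite (E d) ?(E d x) ?(E d y) ?fsubsetUr //; first last.
- exact: fsubset_trans (fsubsetUl _ _) (fsubsetUl _ _).
- exact: fsubset_trans (fsubsetUr _ _) (fsubsetUl _ _).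
rewrite scaler_sumr -big_split; apply: eq_bigr => t _ /=.
by rewrite mcoeffD mcoeffZ scalerDl scalerA.
Qed.
HB.instance Definition _ :=
  GRing.isLinear.Build F2 {malg F2[T]} V *:%R linext_fun linext_linear.
Definition linext : {linear {malg F2[T]} -> V} := linext_fun.

Lemma linextU t : linext << t >> = h t.
Proof.
by rewrite /= /linext_fun msuppU oner_eq0 big_seq_fset1 mcoeffUU scale1r.
Qed.

End FreeModule.

Section Tensor.
Variables V W : lmodType F2.

Inductive tensor_rel : {malg F2[(V * W)%type]} -> Prop :=
| TensorDl v v' w : tensor_rel (<< (v + v', w) >> - << (v, w) >> - << (v', w) >>)
| TensorDr v w w' : tensor_rel (<< (v, w + w') >> - << (v, w) >> - << (v, w') >>)
| TensorZl c v w : tensor_rel (<< (c *: v, w) >> - c *: << (v, w) >>)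
| TensorZr c v w : tensor_rel (<< (v, c *: w) >> - c *: << (v, w) >>).

Definition tensor : lmodType F2 := quotsp tensor_rel.

Definition tens (v : V) (w : W) : tensor := projsp tensor_rel << (v, w) >>.

Fact tens_rel0 x : tensor_rel x -> projsp tensor_rel x = 0.
Proof.
by move=> hx; rewrite -[RHS](raddf0 (projsp tensor_rel)); apply: projsp_eq;
  rewrite subr0 mem_span.
Qed.

Lemma tensDl v v' w : tens (v + v') w = tens v w + tens v' w.
Proof.
apply/eqP; rewrite -subr_eq0 opprD addrA -!raddfB.
exact/eqP/tens_rel0/TensorDl.
Qed.
Lemma tensDr v w w' : tens v (w + w') = tens v w + tens v w'.
Proof.
apply/eqP; rewrite -subr_eq0 opprD addrA -!raddfB.
exact/eqP/tens_rel0/TensorDr.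
Qed.
Lemma tensZl c v w : tens (c *: v) w = c *: tens v w.
Proof.
apply/eqP; rewrite -subr_eq0 -linearZ -raddfB; exact/eqP/tens_rel0/TensorZl.
Qed.
Lemma tensZr c v w : tens v (c *: w) = c *: tens v w.
Proof.
apply/eqP; rewrite -subr_eq0 -linearZ -raddfB; exact/eqP/tens_rel0/TensorZr.
Qed.

End Tensor.

Section TensorMap.
Variables (V W V' W' : lmodType F2).
Variables (f : {linear V -> V'}) (g : {linear W -> W'}).

Let h := linext (fun p : V * W => tens (f p.1) (g p.2)).
Fact tmap_rel x : tensor_rel x -> h x = 0.
Proof.
case=> *; rewrite !(linearB, linearZ) /= !linextU /= !(linearD, linearZ) /=
  ?(tensDl, tensDr, tensZl, tensZr) ?subrr //.
- by rewrite -addrA -opprD subrr.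
- by rewrite -addrA -opprD subrr.
- by rewrite scalerN subrr.
- by rewrite scalerN subrr.
Qed.
Definition tmap : {linear tensor V W -> tensor V' W'} := liftsp tmap_rel.

Lemma tmapE v w : tmap (tens v w) = tens (f v) (g w).
Proof. by rewrite /tmap liftspE linextU. Qed.

End TensorMap.

(* The free monoid on nat consists of the words in the indices, so this is the
   free associative unital F2-algebra on the Q i. *)
Definition F0 : Type := {malg F2[{fmonom nat}]}.
HB.instance Definition _ := GRing.Lalgebra.on F0.

Fact F0_scaleAr (c : F2) (x y : F0) : c *: (x * y) = x * (c *: y).
Proof. by rewrite !scaleF2 mulrnAr. Qed.
HB.instance Definition _ := GRing.Lalgebra_isAlgebra.Build F2 F0 F0_scaleAr.

Definition Q (i : nat) : F0 := << fmu i >>.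

Definition Qz (n : int) : F0 := if n is Posz i then Q i else 0.

Definition monQ (I : seq nat) : F0 := \prod_(i <- I) Q i.

(* (n choose m) mod 2 for integers n and m: it is 0 for m < 0, and for n < 0 it
   is given by (n choose m) = (-1)^m (m - n - 1 choose m); the sign is 1 in
   'F_2. *)
Definition binz (n m : int) : F2 :=
  match m, n with
  | Negz _, _ => 0
  | Posz m, Posz n => 'C(n, m)%:R
  | Posz m, Negz n => 'C(m + n, m)%:R
  end.

(* A sequence (i_k, ..., i_1) is the list [:: i_k; ...; i_1]. *)
Definition excess (I : seq nat) : int :=
  (head 0%N I)%:Z - (sumn (behead I))%:Z.

(* The terms with t > r + s vanish, because Q^j = 0 for j < 0. *)
Definition adem (r s : nat) : F0 :=
  Q r * Q s - \sum_(1 <= t < (r + s).+1)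
    binz (t%:Z - s%:Z - 1) (2 * t%:Z - r%:Z) *: (Q (r + s - t) * Q t).

Inductive dl_gen : F0 -> Prop :=
| NegativeExcess I of excess I < 0 : dl_gen (monQ I)
| Adem r s of (2 * s < r)%N : dl_gen (adem r s).

Definition dl_ideal (x : F0) : Prop :=
  exists a b y, dl_gen y /\ x = a * y * b.

(* Dividing F0 by the ideal generated by the monomials of negative excess and
   the Adem relations together amounts to first forming the quotient U by the
   former, and then the quotient of U by the latter. *)
Definition R : Type := quotsp dl_ideal.
HB.instance Definition _ := GRing.Lmodule.on R.

Definition projR : {linear F0 -> R} := projsp dl_ideal.

Fact span_idealM a b x : x \in span dl_ideal -> a * x * b \in span dl_ideal.
Proof.
move=> /asboolP[s [hs ->]]; rewrite mulr_sumr mulr_suml big_seq.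
apply: rpred_sum => p /hs [c [d [y [hy ->]]]].
rewrite -scalerAr -scalerAl rpredZ // mem_span //.
by exists (a * c), (d * b), y; rewrite !mulrA.
Qed.

Definition oneR : R := projR 1.
Definition mulR (x y : R) : R := projR (repr x * repr y).

Fact projRM x y : projR (x * y) = mulR (projR x) (projR y).
Proof.
apply: projsp_eq; rewrite -opprB rpredN.
rewrite -[X in X - _](addrNK (repr (projR x) * y)) -mulrBr -addrA -mulrBl.
apply: rpredD.
  by rewrite -[_ * (_ - _)]mulr1 span_idealM // repr_projsp.
by rewrite -[_ - _]mul1r span_idealM // repr_projsp.
Qed.

Fact projR_repr (x : R) : projR (repr x) = x.
Proof. exact: projsp_fun_repr. Qed.

Fact mulRA : associative mulR.
Proof.
move=> x y z; rewrite -[x]projR_repr -[y]projR_repr -[z]projR_repr.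
by rewrite -!projRM mulrA.
Qed.
Fact mul1R : left_id oneR mulR.
Proof. by move=> x; rewrite -[x]projR_repr -projRM mul1r. Qed.
Fact mulR1 : right_id oneR mulR.
Proof. by move=> x; rewrite -[x]projR_repr -projRM mulr1. Qed.
Fact mulRDl : left_distributive mulR +%R.
Proof.
move=> x y z; rewrite -[x]projR_repr -[y]projR_repr -[z]projR_repr.
by rewrite -(raddfD projR) -!projRM -(raddfD projR) mulrDl.
Qed.
Fact mulRDr : right_distributive mulR +%R.
Proof.
move=> x y z; rewrite -[x]projR_repr -[y]projR_repr -[z]projR_repr.
by rewrite -(raddfD projR) -!projRM -(raddfD projR) mulrDr.
Qed.
HB.instance Definition _ :=
  GRing.Zmodule_isPzRing.Build R mulRA mul1R mulR1 mulRDl mulRDr.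

Lemma projR1 : projR 1 = 1. Proof. by []. Qed.
Lemma projR_mul x y : projR (x * y) = projR x * projR y.
Proof. exact: projRM. Qed.

Definition lmulQ (i : nat) (x : F0) : F0 := Q i * x.
Fact lmulQ_linear i : linear (lmulQ i).
Proof. by move=> c x y; rewrite /lmulQ mulrDr scalerAr. Qed.
HB.instance Definition _ i :=
  GRing.isLinear.Build F2 F0 F0 *:%R (lmulQ i) (lmulQ_linear i).

(* psi is multiplicative: psi (Q^i x) = psi (Q^i) psi (x), where the product by
   Q^(i - t) (x) Q^t in F0 (x) F0 is left multiplication on each factor. *)
Fixpoint psi_word (I : seq nat) : tensor F0 F0 :=
  if I is i :: J then
    \sum_(t < i.+1) tmap (lmulQ (i - t)) (lmulQ t) (psi_word J)
  else tens 1 1.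

Definition psi : {linear F0 -> tensor F0 F0} :=
  linext (fun I : {fmonom nat} => psi_word I).

(* The counit of psi: the algebra map with Q^0 |-> 1 and Q^i |-> 0 for i > 0. *)
Definition eps : {linear F0 -> F2^o} :=
  linext (fun I : {fmonom nat} => (all (pred1 0%N) I)%:R : F2^o).

(* The summands with 2 t > a vanish. On the empty word, Sq^0 is the identity and
   Sq^a is zero for a > 0; the formula for Sq^a (Q^b) is then the case of a word
   of length 1, see Sq_Q. *)
Fixpoint Sq_word (I : seq nat) (a : nat) : F0 :=
  match I with
  | [::] => (a == 0%N)%:R
  | 0%N :: J => Q 0 * Sq_word J a
  | b :: J => \sum_(t < a.+1)
      binz (b%:Z - a%:Z) (a%:Z - 2 * t%:Z) *:
        (Qz (b%:Z - a%:Z + t%:Z) * Sq_word J t)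
  end.

Definition Sq (a : nat) : {linear F0 -> F0} :=
  linext (fun I : {fmonom nat} => Sq_word I a).

Lemma QE i : Q i = << fmu i >>. Proof. by []. Qed.

Lemma monQE I : monQ I = << FMonom I >>.
Proof.
elim: I => [|i I IH]; first by rewrite /monQ big_nil -fmoneE.
rewrite /monQ big_cons -/(monQ I) IH.
apply/malgP => w; rewrite malgM_def fgmulUU mulr1.
by rewrite -[mmul _ _]/(fmmul _ _) fmmulE fmuE.
Qed.

Lemma psi_Q i : psi (Q i) = \sum_(t < i.+1) tens (Q (i - t)) (Q t).
Proof.
rewrite linextU fmuE.
transitivity (\sum_(t < i.+1) tmap (lmulQ (i - t)) (lmulQ t) (tens 1 1)) => //.
by apply: eq_bigr => t _; rewrite tmapE /= /lmulQ !mulr1.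
Qed.

Lemma Sq_Q a b : Sq a (Q b) = binz (b%:Z - a%:Z) a%:Z *: Qz (b%:Z - a%:Z).
Proof.
rewrite linextU fmuE /=; case: b => [|b].
  case: a => [|a]; first by rewrite mulr1 subr0 /= bin0 scale1r.
  by rewrite mulr0 scaler0.
rewrite big_ord_recl big1 => [|t _]; last by rewrite mulr0 scaler0.
by rewrite mulr0 subr0 addr0 mulr1 addr0.
Qed.

(* The operations of a coalgebra with an action of the opposite of the Steenrod
   algebra, which the Sq^a generate. The axioms need no separate record: R and
   its subspaces receive their operations from F0. *)
Record aopCoalg (V : lmodType F2) := AopCoalg {
  comul : {linear V -> tensor V V};
  counit : {linear V -> F2^o};
  sqop : nat -> {linear V -> V}
}.

Definition aopCoalg_map (V W : lmodType F2)
    (cV : aopCoalg V) (cW : aopCoalg W) (f : {linear V -> W}) : Prop :=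
  [/\ forall x, comul cW (f x) = tmap f f (comul cV x),
      forall x, counit cW (f x) = counit cV x
    & forall a x, sqop cW a (f x) = f (sqop cV a x)].

Definition F0_aopCoalg : aopCoalg F0 := AopCoalg psi eps Sq.

Definition Rk_gen (k : nat) (x : R) : Prop :=
  exists I : k.-tuple nat, x = projR (monQ I).

Definition Rk (k : nat) : lmodType F2 := subsp (Rk_gen k).

Definition inclRk (k : nat) : {linear Rk k -> R} := inclsp (Rk_gen k).

Fact Rk_gen_monQ k (I : k.-tuple nat) : projR (monQ I) \in span (Rk_gen k).
Proof. by apply: mem_span; exists I. Qed.

Definition QR (k : nat) (I : k.-tuple nat) : Rk k := insp (Rk_gen_monQ I).

Definition rmulQ0 (x : R) : R := x * projR (Q 0).
Fact rmulQ0_linear : linear rmulQ0.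
Proof. by move=> c x y; rewrite /rmulQ0 !scaleF2 mulrDl mulrnAl. Qed.
HB.instance Definition _ :=
  GRing.isLinear.Build F2 R R *:%R rmulQ0 rmulQ0_linear.

Fact rmulQ0_monQ I : rmulQ0 (projR (monQ I)) = projR (monQ (rcons I 0%N)).
Proof. by rewrite /monQ -cats1 big_cat big_seq1 projR_mul. Qed.

Fact phi_subproof k (x : Rk k) : rmulQ0 (inclRk k x) \in span (Rk_gen k.+1).
Proof.
apply: (@span_ind _ (Rk_gen k) _ rmulQ0) (valP x) => _ [I ->].
by apply: mem_span; exists [tuple of rcons I 0%N]; apply: rmulQ0_monQ.
Qed.

Definition phi_fun (k : nat) (x : Rk k) : Rk k.+1 := insp (phi_subproof x).
Fact phi_linear k : linear (@phi_fun k).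
Proof. by move=> c x y; apply: val_inj; rewrite /= !linearP. Qed.
HB.instance Definition _ k :=
  GRing.isLinear.Build F2 (Rk k) (Rk k.+1) *:%R (@phi_fun k) (@phi_linear k).

Definition phi (k : nat) : {linear Rk k -> Rk k.+1} := @phi_fun k.

Lemma phiE k (I : k.-tuple nat) : phi k (QR I) = QR [tuple of rcons I 0%N].
Proof. by apply: val_inj; apply: rmulQ0_monQ. Qed.

Definition admissible (I : seq nat) : bool :=
  sorted (fun i j => i <= 2 * j)%N I.

(* Entries are numbered from 0, so that entry j is the one usually numbered
   j + 1, namely i_(k - j). *)
Definition seqI (k t : nat) : k.-tuple nat :=
  [tuple (if (j < t)%N then 2 ^ (k - j.+1) - 2 ^ (t - j.+1)
          else 2 ^ (k - j.+1))%N | j < k].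

Definition seq_comb (n k : nat) (c : 'I_n -> nat) (S : 'I_n -> k.-tuple nat) :
    k.-tuple nat :=
  [tuple (\sum_(i < n) c i * tnth (S i) j)%N | j < k].

(* Main.v *)
Require Import Defs.
From HB Require Import structures.
From mathcomp Require Import all_boot all_order all_algebra.
From mathcomp Require Import finmap zify.
From mathcomp.multinomials Require Import monalg.
From mathcomp.classical Require Import boolp.

Set Implicit Arguments.
Unset Strict Implicit.
Unset Printing Implicit Defensive.

Import GRing.Theory.
Local Open Scope ring_scope.

(** Both vanishing and the formula for phi come from one identity in [R]: for
    every sequence [I], Q^I Q^0 is zero when [I] has an odd entry, and is
    Q^s Q^H when I = 2H and s is the sum of [H] ([projR_monQ_rcons0]). It is
    proved from the right: once Q^0 has absorbed the halved tail and become
    Q^s Q^H, the next letter Q^r meets Q^s, and the Adem relation for Q^r Q^s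
    puts monomials Q^(r+s-t) Q^t Q^H in its place. Their coefficient is zero
    unless r <= 2t, and their excess is r - 2t because the entries of [H] add
    up to s. So the relations of negative excess leave only 2t = r, with
    coefficient 1 ([projR_monQ_halve]).

    For I = sum of 2 a_i I_{k,i} this reads as the formula stated for J, since
    I_{k+1,i+1} is I_{k,i} preceded by its degree 2^k - 2^i ([sum_seqI],
    [seqI_head], [seqI_behead]).

    Right multiplication by Q^0 is a map of coalgebras with operations already
    on the free algebra: Q^0 is group-like, and it can be split off the right
    end of a word in the recursions for psi and for Sq. This passes to the
    quotient [R] ([aopCoalg_map_quot]) and from there to the subspaces R[k]
    ([aopCoalg_map_sub]). The second passage needs R[k+1] (x) R[k+1] to embed
    in R (x) R; this holds because R[k+1] is a retract of [R], the relations
    that define [R] being homogeneous in the length of words ([inclRkK]). *)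

(** * Right multiplication by Q^0 on monomials *)

Lemma monQ_cat I J : monQ (I ++ J) = monQ I * monQ J.
Proof. by rewrite /monQ big_cat. Qed.

Lemma monQ_cons i J : monQ (i :: J) = Q i * monQ J.
Proof. by rewrite /monQ big_cons. Qed.

Lemma projR_dl_gen a y b : dl_gen y -> projR (a * y * b) = 0.
Proof.
move=> y_gen; rewrite -[RHS](raddf0 projR); apply: projsp_eq; rewrite subr0.
by apply: mem_span; exists a, b, y.
Qed.

Lemma projR_negative_excess I J K :
  excess J < 0 -> projR (monQ (I ++ J ++ K)) = 0.
Proof.
move=> /NegativeExcess J_gen; rewrite !monQ_cat mulrA.
exact: projR_dl_gen J_gen.
Qed.

Lemma projR_adem r s : (2 * s < r)%N ->
  projR (Q r * Q s) = \sum_(1 <= t < (r + s).+1)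
    binz (t%:Z - s%:Z - 1) (2 * t%:Z - r%:Z) *: projR (Q (r + s - t) * Q t).
Proof.
move=> /Adem/(projR_dl_gen 1 1).
rewrite mul1r mulr1 linearB => /subr0_eq adem_eq; apply: (etrans adem_eq).
by rewrite linear_sum; apply: eq_bigr => t _; rewrite linearZ.
Qed.

Lemma scaleR_mull (c : F2) (x y : R) : (c *: x) * y = c *: (x * y).
Proof. by rewrite !scaleF2 mulrnAl. Qed.

(** The inductive step of [projR_monQ_rcons0]: with s the sum of [H], the factor
    Q^s Q^H stands for Q^(2H) Q^0. The Adem relation for Q^r Q^s is available
    when r > 2s. When r = 2s the two monomials coincide, and when r < 2s both
    vanish, because Q^r Q^s Q^H and, for even r, Q^(r/2) Q^H have negative
    excess. *)
Lemma projR_monQ_halve r H :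
  projR (monQ [:: r, sumn H & H]) =
  if odd r then 0 else projR (monQ [:: r./2 + sumn H, r./2 & H]%N).
Proof.
set s := sumn H.
have neg i j : (i < j + s)%N -> projR (monQ [:: i, j & H]) = 0.
  move=> lt_i; rewrite -[[:: i, j & H]]cats0.
  by apply: (@projR_negative_excess [::] [:: i, j & H] [::]);
    rewrite /excess /= -/s; lia.
have [r_lt|r_gt|r_eq] := ltngtP r (2 * s)%N; last first.
- by rewrite {1 2}r_eq oddM /=; congr (projR (monQ [:: _, _ & H])); lia.
- have cat2 i j : monQ [:: i, j & H] = Q i * Q j * monQ H.
    by rewrite !monQ_cons mulrA.
  rewrite cat2 projR_mul projR_adem // mulr_suml.
  have term t : binz (t%:Z - s%:Z - 1) (2 * t%:Z - r%:Z) *: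
        projR (Q (r + s - t) * Q t) * projR (monQ H) =
      (if (2 * t == r)%N then projR (monQ [:: r + s - t, t & H]%N) else 0).
    rewrite scaleR_mull -projR_mul -cat2.
    (* The coefficient vanishes below r / 2, and the excess is negative above. *)
    case: (ltngtP (2 * t) r)%N => [lt_t|gt_t|eq_t].
    + have -> : 2 * t%:Z - r%:Z = Negz (r - 2 * t).-1 by lia.
      by rewrite scale0r.
    + by rewrite neg ?scaler0 //; lia.
    + have -> : 2 * t%:Z - r%:Z = 0 by lia.
      have -> : t%:Z - s%:Z - 1 = (t - s - 1)%N by lia.
      by rewrite [binz _ _]/= bin0 scale1r.
  rewrite (eq_bigr _ (fun t _ => term t)).
  case: ifP => odd_r; first by rewrite big1 // => t _; case: eqP => //; lia.
  rewrite (big_rem r./2) /=; last by rewrite mem_index_iota; lia.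
  have -> : (2 * r./2 == r)%N by lia.
  rewrite big1_seq ?addr0; first by congr (projR (monQ [:: _, _ & H])); lia.
  move=> t; rewrite (rem_filter _ (iota_uniq _ _)) mem_filter /=.
  by case/andP=> t_ne _; case: eqP => //; lia.
- rewrite neg; last by lia.
  case: ifP => // _; apply/esym; rewrite -[[:: _, _ & H]]cats0.
  by apply: (@projR_negative_excess [:: _] [:: r./2 & H] [::]);
    rewrite /excess /= -/s; lia.
Qed.

Lemma projR_monQ_rcons0 I :
  projR (monQ (rcons I 0%N)) =
  if has odd I then 0 else projR (monQ (sumn (map half I) :: map half I)).
Proof.
elim: I => [|i I IH] //=.
rewrite monQ_cons projR_mul IH; have [|_] := ifP; first by rewrite orbT mulr0.
by rewrite orbF -projR_mul -monQ_cons projR_monQ_halve.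
Qed.

(** * Linear maps on the free algebra and on tensor products *)

Lemma malg_sumE (T : choiceType) (x : {malg F2[T]}) :
  x = \sum_(t <- msupp x) x@_t *: << t >>.
Proof.
rewrite {1}[x]monalgE; apply: eq_bigr => t _; apply/malgP => u.
by rewrite mcoeffZ !mcoeffU mulrnAr mulr1.
Qed.

Lemma malg_ext (T : choiceType) (V : lmodType F2)
    (f g : {linear {malg F2[T]} -> V}) :
  (forall t, f << t >> = g << t >>) -> f =1 g.
Proof.
move=> fg x; rewrite [x]malg_sumE !linear_sum; apply: eq_bigr => t _.
by rewrite !linearZ /= fg.
Qed.

Lemma F0_sumE (x : F0) : x = \sum_(I <- msupp x) x@_I *: monQ I.
Proof.
rewrite {1}[x]malg_sumE; apply: eq_bigr => -[I] _.
by rewrite monQE.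
Qed.

Lemma F0_ext (V : lmodType F2) (f g : {linear F0 -> V}) :
  (forall I, f (monQ I) = g (monQ I)) -> f =1 g.
Proof. by move=> fg; apply: malg_ext => -[I]; have := fg I; rewrite monQE. Qed.

Lemma tensor_ext (V W U : lmodType F2) (f g : {linear tensor V W -> U}) :
  (forall v w, f (tens v w) = g (tens v w)) -> f =1 g.
Proof.
move=> fg z; rewrite -[z]projsp_fun_repr.
have fgP : f \o projsp (@tensor_rel V W) =1 g \o projsp (@tensor_rel V W).
  by apply: malg_ext => -[v w]; apply: fg.
exact: fgP.
Qed.

Lemma eq_tmap (V W V' W' : lmodType F2)
    (f f' : {linear V -> V'}) (g g' : {linear W -> W'}) :
  f =1 f' -> g =1 g' -> tmap f g =1 tmap f' g'.
Proof.
by move=> ff' gg'; apply: tensor_ext => v w; rewrite !tmapE ff' gg'.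
Qed.

Lemma tmap_comp (V W V' W' V'' W'' : lmodType F2)
    (f : {linear V -> V'}) (g : {linear W -> W'})
    (f' : {linear V' -> V''}) (g' : {linear W' -> W''}) z :
  tmap f' g' (tmap f g z) = tmap (f' \o f) (g' \o g) z.
Proof.
suff: tmap f' g' \o tmap f g =1 tmap (f' \o f) (g' \o g) by apply.
apply: tensor_ext => v w.
by rewrite -[LHS]/(tmap f' g' (tmap f g (tens v w))) !tmapE.
Qed.

Lemma tmap_can (V V' : lmodType F2) (f : {linear V -> V'})
    (g : {linear V' -> V}) :
  cancel f g -> cancel (tmap f f) (tmap g g).
Proof.
move=> fK; suff: tmap g g \o tmap f f =1 idfun by [].
apply: tensor_ext => v w.
by rewrite -[LHS]/(tmap g g (tmap f f (tens v w))) !tmapE !fK.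
Qed.

(** * Descent of coalgebra maps to quotients and to retracts *)

Lemma aopCoalg_map_quot (A B A' B' : lmodType F2)
    (cA : aopCoalg A) (cB : aopCoalg B)
    (cA' : aopCoalg A') (cB' : aopCoalg B')
    (p : {linear A -> B}) (q : {linear A' -> B'})
    (f : {linear A -> A'}) (g : {linear B -> B'}) :
  aopCoalg_map cA cB p -> aopCoalg_map cA' cB' q -> aopCoalg_map cA cA' f ->
  (forall y, exists x, y = p x) -> (forall x, g (p x) = q (f x)) ->
  aopCoalg_map cB cB' g.
Proof.
move=> [pC pE pS] [qC qE qS] [fC fE fS] p_onto gp.
split=> [y|y|a y]; have [x ->] := p_onto y.
- rewrite gp qC fC pC !tmap_comp; apply: eq_tmap => v /=; exact/esym/gp.
- by rewrite gp qE fE pE.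
- by rewrite gp qS fS pS gp.
Qed.

(** Comultiplications are compared after mapping A' (x) A' into B' (x) B'. The
    retraction [r] of [j], only a linear map, makes that map injective. *)
Lemma aopCoalg_map_sub (A B A' B' : lmodType F2)
    (cA : aopCoalg A) (cB : aopCoalg B)
    (cA' : aopCoalg A') (cB' : aopCoalg B')
    (i : {linear A -> B}) (j : {linear A' -> B'}) (r : {linear B' -> A'})
    (f : {linear A -> A'}) (g : {linear B -> B'}) :
  aopCoalg_map cA cB i -> aopCoalg_map cA' cB' j -> aopCoalg_map cB cB' g ->
  cancel j r -> (forall x, j (f x) = g (i x)) ->
  aopCoalg_map cA cA' f.
Proof.
move=> [iC iE iS] [jC jE jS] [gC gE gS] jK jf.
split=> [x|x|a x].
- apply: (can_inj (tmap_can jK)).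
  rewrite -jC jf gC iC !tmap_comp; apply: eq_tmap => v /=; exact/esym/jf.
- by rewrite -jE jf gE iE.
- by apply: (can_inj jK); rewrite -jS jf gS iS jf.
Qed.

(** * Right multiplication by Q^0 on the free algebra *)

Definition F0_rmulQ0 (x : F0) : F0 := x * Q 0.
Fact F0_rmulQ0_linear : linear F0_rmulQ0.
Proof. by move=> c x y; rewrite /F0_rmulQ0 mulrDl scalerAl. Qed.
HB.instance Definition _ :=
  GRing.isLinear.Build F2 F0 F0 *:%R F0_rmulQ0 F0_rmulQ0_linear.

Lemma F0_rmulQ0_monQ I : F0_rmulQ0 (monQ I) = monQ (rcons I 0%N).
Proof. by rewrite -cats1 monQ_cat /monQ big_seq1. Qed.

Lemma psi_word_cons i J : psi_word (i :: J) =
  \sum_(t < i.+1) tmap (lmulQ (i - t)) (lmulQ t) (psi_word J).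
Proof. by []. Qed.

(** Since psi (Q^0) = Q^0 (x) Q^0 and psi peels off letters on the left, the
    last letter Q^0 multiplies each factor on the right. *)
Lemma psi_word_rcons0 I :
  psi_word (rcons I 0%N) = tmap F0_rmulQ0 F0_rmulQ0 (psi_word I).
Proof.
elim: I => [|i I IH].
  rewrite [RHS]tmapE [LHS]big_ord1 [LHS]tmapE.
  by rewrite /= /lmulQ /F0_rmulQ0 mulr1 mul1r.
rewrite rcons_cons !psi_word_cons [RHS]linear_sum; apply: eq_bigr => t _.
rewrite IH [LHS]tmap_comp [RHS]tmap_comp.
by apply: eq_tmap => x; apply: mulrA.
Qed.

(** On the one-letter word Q^0 only Sq^0 is nonzero, so Q^0 behaves like the
    empty word at the end of the recursion. *)
Lemma Sq_word_rcons0 I a : Sq_word (rcons I 0%N) a = F0_rmulQ0 (Sq_word I a).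
Proof.
elim: I a => [|[|i] I IH] a /=.
- by rewrite /F0_rmulQ0; case: eqP => _; rewrite ?mulr0 ?mul0r ?mulr1 ?mul1r.
- by rewrite IH /F0_rmulQ0 mulrA.
- rewrite linear_sum; apply: eq_bigr => t _.
  by rewrite linearZ /= IH /F0_rmulQ0 mulrA.
Qed.

Lemma F0_rmulQ0_aopCoalg_map : aopCoalg_map F0_aopCoalg F0_aopCoalg F0_rmulQ0.
Proof.
split=> [||a].
- suff: psi \o F0_rmulQ0 =1 tmap F0_rmulQ0 F0_rmulQ0 \o psi by [].
  apply: F0_ext => I; rewrite /= F0_rmulQ0_monQ !monQE !linextU.
  exact: psi_word_rcons0.
- suff: eps \o F0_rmulQ0 =1 eps by [].
  apply: F0_ext => I; rewrite /= F0_rmulQ0_monQ !monQE !linextU.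
  by rewrite /= all_rcons.
- suff: Sq a \o F0_rmulQ0 =1 F0_rmulQ0 \o Sq a by [].
  apply: F0_ext => I; rewrite /= F0_rmulQ0_monQ !monQE !linextU.
  exact: Sq_word_rcons0.
Qed.

(** * The subspaces of fixed length are retracts *)

Section LengthPart.
Variable k : nat.

(** The projection of the free algebra onto its words of length [k], followed
    by the quotient map to [R]. *)
Definition lenpart0 : {linear F0 -> R} :=
  linext (fun I : {fmonom nat} => if size I == k then projR (monQ I) else 0 : R).

Lemma lenpart0_monQ I :
  lenpart0 (monQ I) = if size I == k then projR (monQ I) else 0.
Proof. by rewrite {1}monQE linextU. Qed.

(** The generators of the ideal are homogeneous for the length: a single word,
    or a combination of words of length 2. Hence [lenpart0] agrees on them,
    between any two words, with [projR] or with zero. *)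
Lemma lenpart0_gen u v y :
  dl_gen y -> lenpart0 (monQ u * y * monQ v) = 0.
Proof.
case=> [I neg_I|r s lt_sr].
  rewrite -!monQ_cat lenpart0_monQ; case: ifP => // _.
  by rewrite -catA projR_negative_excess.
have len_quad i j : lenpart0 (monQ u * (Q i * Q j) * monQ v) =
    projR (monQ u * (Q i * Q j) * monQ v) *+ (size u + 2 + size v == k)%N.
  have -> : Q i * Q j = monQ [:: i; j] by rewrite /monQ !big_cons big_nil mulr1.
  by rewrite -!monQ_cat lenpart0_monQ !size_cat mulrb.
have -> : lenpart0 (monQ u * adem r s * monQ v) =
    projR (monQ u * adem r s * monQ v) *+ (size u + 2 + size v == k)%N.
  rewrite /adem mulrBr mulrBl [LHS]linearB [projR _]linearB [RHS]mulrnBl.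
  rewrite [X in X - _ = _]len_quad; congr (_ - _).
  rewrite mulr_sumr mulr_suml [LHS]linear_sum [projR _]linear_sum.
  rewrite -[RHS]sumrMnl; apply: eq_bigr => t _.
  rewrite -scalerAr -scalerAl [LHS]linearZ [projR _]linearZ.
  by rewrite len_quad [RHS]scalerMnr.
by rewrite (projR_dl_gen _ _ (Adem lt_sr)) mul0rn.
Qed.

Lemma lenpart0_ideal x : dl_ideal x -> lenpart0 x = 0.
Proof.
move=> [a [b [y [y_gen ->]]]].
rewrite -mulrA (F0_sumE a) mulr_suml linear_sum big1 // => u _.
rewrite -scalerAl linearZ mulrA (F0_sumE b) mulr_sumr linear_sum.
rewrite big1 => [|v _]; first exact: scaler0.
by rewrite -scalerAr linearZ lenpart0_gen //; apply: scaler0.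
Qed.

Definition lenpart : {linear R -> R} := liftsp lenpart0_ideal.

Lemma lenpart_projR y : lenpart (projR y) = lenpart0 y.
Proof. exact: liftspE. Qed.

Lemma lenpart_span x : lenpart x \in Defs.span (Rk_gen k).
Proof.
rewrite -[x]projR_repr lenpart_projR (F0_sumE (repr x)) linear_sum.
apply: rpred_sum => I _; rewrite linearZ lenpart0_monQ.
apply/rpredZ; case: ifP => [sz_I|_]; last exact: rpred0.
exact: (Rk_gen_monQ (Tuple sz_I)).
Qed.

Definition retrRk_fun (x : R) : Rk k := insp (lenpart_span x).
Fact retrRk_linear : linear retrRk_fun.
Proof. by move=> c x y; apply: val_inj; exact: linearP. Qed.
HB.instance Definition _ :=
  GRing.isLinear.Build F2 R (Rk k) *:%R retrRk_fun retrRk_linear.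
Definition retrRk : {linear R -> Rk k} := retrRk_fun.

Lemma inclRkK : cancel (inclRk k) retrRk.
Proof.
move=> x; apply: val_inj; rewrite -[LHS]/(lenpart (val x)).
have /asboolP[s [s_gen ->]] := valP x.
rewrite linear_sum; apply: eq_big_seq => p /s_gen[I ->].
by rewrite linearZ lenpart_projR lenpart0_monQ size_tuple eqxx.
Qed.

End LengthPart.

(** * The sequences I_{k,t} *)

Lemma seqI_head k t :
  tnth (seqI k.+1 t.+1) ord0 = (2 ^ k - 2 ^ t)%N.
Proof. by rewrite tnth_mktuple /= !subSS !subn0. Qed.

Lemma seqI_behead k t (j : 'I_k) :
  tnth (seqI k.+1 t) (lift ord0 j) = tnth (seqI k t.-1) j.
Proof.
by rewrite !tnth_mktuple lift0 !subSS; case: t.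
Qed.

(** Dropping the first entry of I_{k+1,t} leaves I_{k,t-1}, or I_{k,0} if t = 0,
    so the degree follows by induction on the length. *)
Lemma sum_seqI k t : (t <= k)%N ->
  (\sum_(j < k) tnth (seqI k t) j = 2 ^ k - 2 ^ t)%N.
Proof.
elim: k t => [|k IH] t le_tk; first by case: t le_tk; rewrite ?big_ord0.
rewrite big_ord_recl (eq_bigr _ (fun j _ => seqI_behead _ j)) IH; last by lia.
have le_pow : (2 ^ t.-1 <= 2 ^ k)%N by rewrite leq_exp2l //; lia.
case: t le_tk le_pow => [|t] _ /= le_pow; last by rewrite seqI_head !expnS; lia.
by rewrite tnth_mktuple /= subSS subn0 expnS; lia.
Qed.

(** * The map phi *)

(* In the first conjunct, cR is the quotient structure that R receives from F0,
   and ck, ck1 are the structures of R[k], R[k+1] as subobjects of R. *)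
Theorem proposition4 (k : nat) (hk : (1 <= k)%N) :
  (forall (cR : aopCoalg R) (ck : aopCoalg (Rk k)) (ck1 : aopCoalg (Rk k.+1)),
      aopCoalg_map F0_aopCoalg cR projR ->
      aopCoalg_map ck cR (inclRk k) ->
      aopCoalg_map ck1 cR (inclRk k.+1) ->
      aopCoalg_map ck ck1 (phi k))
  /\ (forall I : k.-tuple nat,
        ~ (forall j : 'I_k, exists m : nat, tnth I j = (2 * m)%N) ->
        admissible I ->
        phi k (QR I) = 0)
  /\ (forall (a : 'I_k -> nat) (I : k.-tuple nat) (J : k.+1.-tuple nat),
        I = seq_comb (fun i => (2 * a i)%N) (fun i => seqI k i) ->
        J = seq_comb a (fun i => seqI k.+1 i.+1) ->
        phi k (QR I) = QR J).
Proof.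
split; last split.
- move=> cR ck ck1 cR_map ck_map ck1_map.
  apply: (aopCoalg_map_sub ck_map ck1_map _ (@inclRkK k.+1) (g := rmulQ0)) => //.
  apply: (aopCoalg_map_quot cR_map cR_map F0_rmulQ0_aopCoalg_map) => y.
    by exists (repr y); rewrite projR_repr.
  exact/esym/projR_mul.
- move=> I I_odd _; rewrite phiE; apply: val_inj => /=.
  rewrite projR_monQ_rcons0; case: hasP => // I_even; case: I_odd => j.
  exists (tnth I j)./2; apply: contrapT => j_odd; case: I_even.
  by exists (tnth I j); [exact: mem_tnth | lia].
- move=> a I J I_def J_def; rewrite phiE; apply: val_inj => /=.
  pose H := seq_comb a (fun i => seqI k i).
  have I_tnth j : tnth I j = (2 * tnth H j)%N.
    rewrite I_def !tnth_mktuple big_distrr; apply: eq_bigr => i _.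
    exact/esym/mulnA.
  rewrite projR_monQ_rcons0.
  have -> : has odd I = false.
    by apply/hasP => -[n /tnthP[j ->]]; rewrite I_tnth; lia.
  have -> : map half I = H :> seq nat.
    congr tval; apply: eq_from_tnth => j.
    by rewrite tnth_map I_tnth; lia.
  congr (projR (monQ _)).
  suff -> : J = [tuple of sumn H :: H] by [].
  apply: eq_from_tnth => j; rewrite J_def tnth_mktuple.
  have [j' ->|->] := unliftP ord0 j.
    rewrite tnthS tnth_mktuple; apply: eq_bigr => i _.
    by rewrite seqI_behead.
  rewrite [RHS]tnth0 sumnE big_tuple.
  under [RHS]eq_bigr do rewrite tnth_mktuple.
  rewrite exchange_big; apply: eq_bigr => i _.
  by rewrite -big_distrr /= sum_seqI 1?ltnW // seqI_head.
Qed.
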